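(* Let $L\ge2$ be an integer and let $$\mathcal{F}_L=\Big\{f(\theta)=\frac{La\theta+b}{Lc\theta+c}:\ a,b,c\in\mathbb{R},\ c>a\ge b>0,\ \frac{a}{b}\in\mathbb{N}\Big\}.$$ For every $f\in\mathcal{F}_L$ there exists a homogeneous Moran set $E$ (in some $\mathbb{R}^d$) such that $$\overline{\dim}_\theta E=\begin{cases} f(\theta), & \theta\in[\frac1{L^2},1],\\ \dim_H E, & \theta\in[0,\frac1{L^2}],\end{cases}$$ and $\underline{\dim}_\theta E=\dim_H E$ for all $\theta\in[0,1]$.
   Context: Intermediate dimensions. $|\cdot|$ denotes the diameter of a set and $\dim_H$ the Hausdorff dimension. For $E\subset\mathbb{R}^d$ and $0\le\theta\le1$ (with $\delta^{1/\theta}$ read as $0$ when $\theta=0$, so that both dimensions equal $\dim_H E$): $\underline{\dim}_\theta E=\inf\{s\ge0:$ for all $\varepsilon>0$ and $\Delta>0$ there exist $0<\delta\le\Delta$ and a cover $\{U_i\}$ of $E$ such that $\delta^{1/\theta}\le|U_i|\le\delta$ for all $i$ and $\sum|U_i|^s\le\varepsilon\}$; $\overline{\dim}_\theta E=\inf\{s\ge0:$ for all $\varepsilon>0$ there exists $\Delta>0$ such that for all $0<\delta\le\Delta$ there is a cover $\{U_i\}$ of $E$ such that $\delta^{1/\theta}\le|U_i|\le\delta$ for all $i$ and $\sum|U_i|^s\le\varepsilon\}$. Homogeneous Moran sets. Let $\{n_k\}_{k\ge1}$ be integers $\ge2$. $\Sigma^k=\{u_1\cdots u_k:1\le u_j\le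 n_j\}$, $\Sigma^0=\{\emptyset\}$, $\Sigma^*=\bigcup_{k\ge0}\Sigma^k$. Let $J\subset\mathbb{R}^d$ be compact with nonempty interior, and let $c_k>0$ satisfy $n_kc_k^d\le1$ for all $k\ge1$. Let $\{J_{\mathbf{u}}:\mathbf{u}\in\Sigma^*\}$ be closed subsets of $J$ such that: (1) for each $\mathbf{u}$ there is a similarity $\Psi_{\mathbf{u}}:\mathbb{R}^d\to\mathbb{R}^d$ with $J_{\mathbf{u}}=\Psi_{\mathbf{u}}(J)$, and $J_\emptyset=J$; (2) for all $k\ge1$ and $\mathbf{u}\in\Sigma^{k-1}$, the sets $J_{\mathbf{u}1},\dots,J_{\mathbf{u}n_k}$ are subsets of $J_{\mathbf{u}}$ with pairwise disjoint interiors and $|J_{\mathbf{u}i}|/|J_{\mathbf{u}}|=c_k$ for $1\le i\le n_k$. Then $E=\bigcap_{k\ge1}\bigcup_{\mathbf{u}\in\Sigma^k}J_{\mathbf{u}}$ is called a homogeneous Moran set. *)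

(* Defs.v *)
From HB Require Import structures.
From mathcomp Require Import all_boot all_order all_algebra.
From mathcomp Require Import all_classical all_reals all_analysis.
Set Implicit Arguments.
Unset Strict Implicit.
Unset Printing Implicit Defensive.
Import Order.TTheory GRing.Theory Num.Theory.
Import numFieldNormedType.Exports.
Local Open Scope classical_set_scope.
Local Open Scope ring_scope.

(* MathComp-Analysis puts the sup norm on 'rV[R]_d: the topology is the usual
   one, but diameters and similarities need the Euclidean distance. *)
Definition edist (R : realType) (d : nat) (x y : 'rV[R]_d) : R :=
  Num.sqrt (\sum_(i < d) (x ord0 i - y ord0 i) ^+ 2).

(* The point 0 is added because ereal_sup set0 = -oo; it makes diam set0 = 0. *)
Definition diam (R : realType) (d : nat) (A : set 'rV[R]_d) : \bar R :=
  ereal_sup (0%E |` [set (edist x.1 x.2)%:E | x in A `*` A]).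

(* A finite or countable family is a family indexed by a set D of naturals. *)
Definition cover_of (R : realType) (d : nat) (E : set 'rV[R]_d)
    (D : set nat) (U : nat -> set 'rV[R]_d) : Prop :=
  E `<=` \bigcup_(i in D) U i.

(* Here 0 `^ 0 = 1.  Null terms only matter at s = 0, which does not affect
   the infima over s below. *)
Definition diam_sum (R : realType) (d : nat) (s : R)
    (D : set nat) (U : nat -> set 'rV[R]_d) : \bar R :=
  (\esum_(i in D) (diam (U i) `^ s))%E.

Definition hausdorff_premeasure (R : realType) (d : nat) (s delta : R)
    (E : set 'rV[R]_d) : \bar R :=
  ereal_inf [set t | exists (D : set nat) (U : nat -> set 'rV[R]_d),
    [/\ cover_of E D U,
        forall i, D i -> (diam (U i) <= delta%:E)%E
      & t = diam_sum s D U]].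

Definition hausdorff_measure (R : realType) (d : nat) (s : R)
    (E : set 'rV[R]_d) : \bar R :=
  ereal_sup [set hausdorff_premeasure s delta E | delta in [set x : R | 0 < x]].

Definition hausdorff_dim (R : realType) (d : nat) (E : set 'rV[R]_d) : \bar R :=
  ereal_inf [set s%:E | s in
    [set s : R | 0 <= s /\ hausdorff_measure s E = 0%E]].

(* delta^(1/theta), read as 0 when theta = 0 *)
Definition lower_scale (R : realType) (theta delta : R) : R :=
  if theta == 0 then 0 else delta `^ theta^-1.

Definition has_theta_cover (R : realType) (d : nat) (theta s eps delta : R)
    (E : set 'rV[R]_d) : Prop :=
  exists (D : set nat) (U : nat -> set 'rV[R]_d),
    [/\ cover_of E D U,
        forall i, D i ->
          ((lower_scale theta delta)%:E <= diam (U i) <= delta%:E)%E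
      & (diam_sum s D U <= eps%:E)%E].

Definition lower_intermediate_dim (R : realType) (d : nat) (theta : R)
    (E : set 'rV[R]_d) : \bar R :=
  ereal_inf [set s%:E | s in [set s : R | 0 <= s /\
    forall eps Delta : R, 0 < eps -> 0 < Delta ->
      exists delta : R, 0 < delta <= Delta /\
        has_theta_cover theta s eps delta E]].

Definition upper_intermediate_dim (R : realType) (d : nat) (theta : R)
    (E : set 'rV[R]_d) : \bar R :=
  ereal_inf [set s%:E | s in [set s : R | 0 <= s /\
    forall eps : R, 0 < eps ->
      exists Delta : R, 0 < Delta /\
        forall delta : R, 0 < delta <= Delta ->
          has_theta_cover theta s eps delta E]].

Definition similarity (R : realType) (d : nat)
    (Psi : 'rV[R]_d -> 'rV[R]_d) : Prop :=
  exists r : R, 0 < r /\ forall x y, edist (Psi x) (Psi y) = r * edist x y.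

(* Sequences (n_k) and (c_k), k >= 1, are functions on nat whose value at 0 is
   unused.  The letter u_j of a word u is nth 0 u (j - 1). *)
Definition words (n : nat -> nat) (k : nat) : set (seq nat) :=
  [set u | size u = k /\
    forall j, (j < k)%N -> (1 <= nth 0%N u j <= n j.+1)%N].

Record moran_structure (R : realType) (d : nat) (n : nat -> nat) (c : nat -> R)
    (J : set 'rV[R]_d) (Js : seq nat -> set 'rV[R]_d) : Prop := {
  moran_n_ge2 : forall k, (1 <= k)%N -> (2 <= n k)%N;
  moran_c_gt0 : forall k, (1 <= k)%N -> 0 < c k;
  moran_nc_le1 : forall k, (1 <= k)%N -> (n k)%:R * c k ^+ d <= 1;
  moran_compact : compact J;
  moran_interior : J° !=set0;
  moran_closed : forall k u, words n k u -> closed (Js u) /\ Js u `<=` J;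
  moran_similar : forall k u, words n k u ->
    exists Psi : 'rV[R]_d -> 'rV[R]_d, similarity Psi /\ Js u = Psi @` J;
  moran_root : Js [::] = J;
  moran_sub : forall k u i, words n k u -> (1 <= i <= n k.+1)%N ->
    Js (rcons u i) `<=` Js u;
  moran_disjoint : forall k u, words n k u ->
    trivIset [set i | (1 <= i <= n k.+1)%N] (fun i => (Js (rcons u i))°);
  moran_ratio : forall k u i, words n k u -> (1 <= i <= n k.+1)%N ->
    fine (diam (Js (rcons u i))) / fine (diam (Js u)) = c k.+1
}.

Definition homogeneous_moran_set (R : realType) (d : nat)
    (E : set 'rV[R]_d) : Prop :=
  exists (n : nat -> nat) (c : nat -> R) (J : set 'rV[R]_d)
         (Js : seq nat -> set 'rV[R]_d),
    moran_structure n c J Js /\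
    E = \bigcap_(k in [set k | (1 <= k)%N]) \bigcup_(u in words n k) Js u.

Definition family_F (R : realType) (L : nat) : set (R -> R) :=
  [set f | exists a b c : R,
    [/\ a < c, b <= a, 0 < b, exists m : nat, a / b = m%:R
      & forall theta : R, 0 <= theta <= 1 ->
          f theta = (L%:R * a * theta + b) / (L%:R * c * theta + c)]].

(* Main.v *)
Require Import Defs.
From mathcomp Require Import all_boot all_order all_algebra.
From mathcomp Require Import all_classical all_reals all_analysis.
From mathcomp Require Import ring lra zify.
Import Order.TTheory GRing.Theory Num.Theory.
Import numFieldNormedType.Exports.
(* Makes edist the Euclidean distance again, and not the extended distance. *)
Import Defs.
Local Open Scope classical_set_scope.
Local Open Scope ring_scope.

(** Write gamma = c / b and m = a / b, so that m < gamma and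
      f theta = phi theta / gamma,
      phi theta = (1 + m L theta) / (1 + L theta).
    The set lives on the line.  All contraction ratios equal
    rho = 2^-gamma, and an interval of level j has either 2^m or 2 children,
    so there are 2^(g k) intervals of level k, where g has slope m or 1.  The
    slope is m for L^(2i) <= j < L^(2i+1) and 1 for L^(2i+1) <= j < L^(2i+2).

    A cover of the set by all intervals of level v shows that, at the scale
    rho^v, the set looks (g v / v) / gamma dimensional.  The ratio g v / v
    oscillates between its minima phi(1/L^2) near the levels L^(2i) and its
    maxima phi(1) near the levels L^(2i+1).  A theta-cover at the scale rho^t
    may use any level in the window [t, t / theta].  Hence the upper
    intermediate dimension is the largest value, over late windows, of the
    minimum of g v / v over the window, divided by gamma.  The worst window
    straddles a maximum T = L^(2i+1) in such a way that both end points give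
    the same ratio; its left end is t = T (1 + L theta) / (1 + L), and the
    common value is phi theta.  This picture is correct as long as the window
    does not extend beyond the neighbouring minima, that is, as long as
    theta >= 1 / L^2; for smaller theta every window contains a minimum.
    The Hausdorff and lower intermediate dimensions see only the minima.

    Upper bounds are explicit covers (count_exponent_upper,
    moran_limit_cover).  Lower bounds come from a mass distribution argument
    (mass_distribution): a set whose diameter r is in the admissible range
    meets at most one interval of a level k comparable with the logarithm of r
    in base rho, so its mass is at most 2^-(g k), which count_exponent_lower and
    count_exponent_global compare with r^s.  The remaining equalities are
    squeezed out of the monotonicity of the intermediate dimensions in theta
    and of dim_H <= lower <= upper. *)

(** * Word counts in alternating blocks *)

Ltac nneg := repeat first [assumption | apply: addr_ge0 | apply: mulr_ge0].

Section Counting.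
Variables (L m : nat).
Hypotheses (L_ge2 : (2 <= L)%N) (m_ge1 : (1 <= m)%N).

(** The block [L^i, L^(i+1)) has index i = trunc_log L j; level 0, whose
    truncated logarithm is 0, is counted with the first block. *)
Definition branching_exponent (j : nat) : nat :=
  if odd (trunc_log L j) then 1%N else m.

Definition count_exponent (k : nat) : nat :=
  (\sum_(j < k) branching_exponent j)%N.

Let b := branching_exponent.
Let g := count_exponent.

Lemma branching_exponent_bounds j : (1 <= b j <= m)%N.
Proof. by rewrite /b /branching_exponent; case: ifP => _; rewrite ?m_ge1 ?leqnn. Qed.

Lemma count_exponentS k : g k.+1 = (g k + b k)%N.
Proof. by rewrite /g /count_exponent big_ord_recr. Qed.

(** Because all slopes lie in [1, m], the values at the block ends L^i
    bound the count exponent at every other level. *)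
Lemma count_exponent_slopes i d : (g i + d <= g (i + d) <= g i + m * d)%N.
Proof.
elim: d => [|d /andP[lo hi]]; first by rewrite !addn0 muln0 addn0 leqnn.
rewrite !addnS count_exponentS; have /andP[] := branching_exponent_bounds (i + d).
by move=> b1 b2; lia.
Qed.

Lemma count_exponent_block i :
  g (L ^ i.+1) = (g (L ^ i) + (if odd i then 1 else m) * (L ^ i.+1 - L ^ i))%N.
Proof.
have leLL : (L ^ i <= L ^ i.+1)%N by rewrite leq_exp2l.
have step d : (d <= L ^ i.+1 - L ^ i)%N ->
    g (L ^ i + d) = (g (L ^ i) + (if odd i then 1 else m) * d)%N.
  elim: d => [|d IHd] ltd; first by rewrite addn0 muln0 addn0.
  rewrite addnS count_exponentS IHd 1?ltnW// /b /branching_exponent.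
  rewrite (@trunc_log_eq L i); [by case: ifP => _; lia | by [] | ].
  by apply/andP; split; lia.
by rewrite -(step _ (leqnn _)) subnKC.
Qed.

(** Both values are affine in L^i with the same additive error
    L (m - 1) / (L + 1): the two asymptotic slopes are the fixed
    point of the affine recursion given by one block of each kind, and the
    error is determined by the value m at level 1. *)
Lemma count_exponent_pow j :
  (L.+1 * g (L ^ j.*2) + L = (L + m) * L ^ j.*2 + L * m)%N /\
  (L.+1 * g (L ^ j.*2.+1) + L = (1 + m * L) * L ^ j.*2.+1 + L * m)%N.
Proof.
have odd_of_even i : ~~ odd i ->
    (L.+1 * g (L ^ i) + L = (L + m) * L ^ i + L * m)%N ->
    (L.+1 * g (L ^ i.+1) + L = (1 + m * L) * L ^ i.+1 + L * m)%N.
  move=> /negbTE ev; rewrite count_exponent_block ev expnS => IH.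
  have : (L ^ i <= L * L ^ i)%N by rewrite leq_pmull//; lia.
  by move=> le; nia.
elim: j => [|j [_ IH]].
  have e0 : (L.+1 * g (L ^ 0) + L = (L + m) * L ^ 0 + L * m)%N.
    rewrite expn0 /g /count_exponent big_ord_recl big_ord0 /branching_exponent.
    by rewrite /= trunc_log0 /=; lia.
  by split=> //; exact: odd_of_even.
suff ev : (L.+1 * g (L ^ j.+1.*2) + L = (L + m) * L ^ j.+1.*2 + L * m)%N.
  by split=> //; apply: odd_of_even; rewrite // odd_double.
rewrite doubleS count_exponent_block /= odd_double/= (expnS _ j.*2.+1).
have : (L ^ j.*2.+1 <= L * L ^ j.*2.+1)%N by rewrite leq_pmull//; lia.
by move: IH => + le; nia.
Qed.

Section Profile.
Variable R : realType.

(** The common value of g v / v at both ends of the worst window. *)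
Definition profile (theta : R) : R :=
  (1 + m%:R * L%:R * theta) / (1 + L%:R * theta).

Let gR (k : nat) : R := (g k)%:R.

Let slopes_up i k : (i <= k)%N ->
  gR i + (k%:R - i%:R) <= gR k <= gR i + m%:R * (k%:R - i%:R).
Proof.
move=> ik; have := count_exponent_slopes i (k - i); rewrite subnKC// => /andP[lo hi].
rewrite -natrB// /gR -natrM -!natrD !ler_nat; apply/andP; split; lia.
Qed.

Let pow_even j : (1 + L%:R) * gR (L ^ j.*2) =
  (L%:R + m%:R) * (L ^ j.*2)%:R + L%:R * (m%:R - 1).
Proof.
have [/(congr1 (fun n => n%:R : R)) + _] := count_exponent_pow j.
rewrite !(natrD, natrM) -natr1 -/(gR _); lra.
Qed.

Let pow_odd j : (1 + L%:R) * gR (L ^ j.*2.+1) =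
  (1 + m%:R * L%:R) * (L ^ j.*2.+1)%:R + L%:R * (m%:R - 1).
Proof.
have [_ /(congr1 (fun n => n%:R : R))] := count_exponent_pow j.
rewrite !(natrD, natrM) -natr1 -/(gR _); lra.
Qed.

Let L2 : 2 <= L%:R :> R. Proof. by rewrite ler_nat. Qed.
Let m1 : 1 <= m%:R :> R. Proof. by rewrite ler1n. Qed.

(** With T = L^(2j+1), the critical window is [t, t / theta] for
    t = T (1 + L theta) / (1 + L).  On it the count exponent stays above the
    line of slope profile theta, because it climbs to its value at T with
    slope at most m and leaves T with slope at least 1, and both of
    these lines meet the line of slope profile theta at the ends of the window,
    up to the additive error of count_exponent_pow.  The window is
    enlarged by K on the left and by 1 on the right, to leave room for the
    constants of the geometry. *)
Lemma count_exponent_lower (theta K : R) (j k : nat) : 0 < theta <= 1 -> 0 <= K ->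
  (L ^ j.*2.+1)%:R * (1 + L%:R * theta) <= (k%:R + K) * (1 + L%:R) ->
  (k%:R - 1) * theta * (1 + L%:R) <= (L ^ j.*2.+1)%:R * (1 + L%:R * theta) ->
  profile theta * k%:R - m%:R * K <= gR k.
Proof.
have x2 := L2; have y1 := m1.
move=> /andP[th0 th1] K0.
have := pow_odd j; have := slopes_up k (L ^ j.*2.+1); have := slopes_up (L ^ j.*2.+1) k.
set T := (_ ^ _)%N; set x := L%:R in x2 *; set y := m%:R in y1 *; set G := gR T.
move=> Tk kT eqG lo hi.
have den0 : 0 < 1 + x * theta by nra.
have xth : 0 < x * theta by nra.
have ym0 : 0 <= y - 1 by lra.
have x0 : 0 <= x by lra.
have y0 : 0 <= y by lra.
have sx0 : 0 <= 1 + x by lra.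
have xth0 : 0 <= x * theta := ltW xth.
have one0 : 0 <= 1 :> R by [].
have th0' : 0 <= 1 - theta by lra.
(* All fractions are cleared by the denominators 1 + x of the values at T
   and 1 + x theta of the profile; both cases then exhibit the difference as
   a sum of nonnegative terms. *)
suff key : 0 <= (1 + x) * ((1 + x * theta) * (gR k + y * K) - (1 + y * x * theta) * k%:R).
  have : 0 <= (1 + x * theta) * (gR k + y * K) - (1 + y * x * theta) * k%:R.
    by rewrite pmulr_rge0 in key => //; lra.
  rewrite subr_ge0 lerBlDr /profile => le; rewrite mulrAC ler_pdivrMr//.
  by rewrite [leRHS]mulrC.
case: (leqP T k) => [/Tk/andP[lb _]|/ltnW/kT/andP[_ ub]].
  have lb0 : 0 <= gR k - (G + (k%:R - T%:R)) by lra.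
  have hi0 : 0 <= T%:R * (1 + x * theta) - (k%:R - 1) * theta * (1 + x) by lra.
  have E : (1 + x) * ((1 + x * theta) * (gR k + y * K) - (1 + y * x * theta) * k%:R) =
    (1 + x) * (1 + x * theta) * (y * K) +
    (1 + x) * (1 + x * theta) * (gR k - (G + (k%:R - T%:R))) +
    (y - 1) * x * ((T%:R * (1 + x * theta) - (k%:R - 1) * theta * (1 + x)) + (1 - theta)) +
    (1 + x * theta) * ((1 + x) * G - ((1 + y * x) * T%:R + x * (y - 1))).
    by ring.
  rewrite E eqG subrr mulr0 addr0; nneg.
have ub0 : 0 <= gR k + y * (T%:R - k%:R) - G by lra.
have lo0 : 0 <= (k%:R + K) * (1 + x) - T%:R * (1 + x * theta) by lra.
have E : (1 + x) * ((1 + x * theta) * (gR k + y * K) - (1 + y * x * theta) * k%:R) =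
    (1 + x) * K * (1 + y * (x * theta)) +
    (1 + x) * (1 + x * theta) * (gR k + y * (T%:R - k%:R) - G) +
    (y - 1) * ((k%:R + K) * (1 + x) - T%:R * (1 + x * theta)) +
    (y - 1) * (1 + x * theta) * x +
    (1 + x * theta) * ((1 + x) * G - ((1 + y * x) * T%:R + x * (y - 1))).
  by ring.
rewrite E eqG subrr mulr0 addr0; nneg.
Qed.

Lemma pow_bracket (t : R) : 1 <= t ->
  exists j, (L ^ j.*2)%:R <= t < (L ^ j.*2.+2)%:R.
Proof.
move=> t1; have t0 : 0 <= t by lra.
have /andP[nt tn] := truncn_itv t0; set n := Num.truncn t in nt tn.
have n0 : (0 < n)%N by rewrite truncn_gt0.
have /andP[lo hi] := trunc_log_bounds L_ge2 n0; set i := trunc_log L n in lo hi.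
exists i./2; apply/andP; split.
  apply: le_trans nt; rewrite ler_nat; apply: leq_trans lo; rewrite leq_exp2l//.
  by rewrite -{2}(odd_double_half i) leq_addl.
apply: (lt_le_trans tn); rewrite ler_nat; apply: (leq_trans hi); rewrite leq_exp2l//.
by rewrite -{1}(odd_double_half i) ltnS; case: (odd i); lia.
Qed.

(** Every window [t, t / theta] contains a level v at which covering is
    cheap.  The level is the left end t if t lies before the critical left end
    of its double block, the right end t / theta if t lies after it and the
    window stops before the next minimum S', and S' otherwise; it is
    rounded up to the level k of actual intervals. *)
Lemma count_exponent_upper (theta t : R) : 1 <= theta * L%:R ^+ 2 -> theta <= 1 ->
  1 <= t -> exists (v : R) (k : nat),
    [/\ t <= v, v * theta <= t, v <= k%:R & gR k <= profile theta * v + 2 * m%:R].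
Proof.
have x2 := L2; have y1 := m1.
move=> th0 th1 t1; have [j /andP[St tS']] := pow_bracket _ t1.
have := pow_even j; have := pow_even j.+1; rewrite doubleS.
have := slopes_up (L ^ j.*2).
have := fun k => slopes_up k (L ^ j.*2.+2).
have : (L ^ j.*2.+2)%:R = L%:R * (L%:R * (L ^ j.*2)%:R) :> R by rewrite -!natrM -!expnS.
move: tS'; set S' := (L ^ j.*2.+2)%N; set S := (L ^ j.*2)%N in St *.
set x := L%:R in x2 th0 *; set y := m%:R in y1 *; rewrite -/x -/y.
move=> tS' eqS' up' up eqG' eqG.
have xth : 0 < theta by rewrite -(@pmulr_lgt0 _ (x ^+ 2)) ?exprn_gt0; lra.
have den0 : 0 < 1 + x * theta by rewrite addr_gt0// mulr_gt0//; lra.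
have th0' : 0 <= theta := ltW xth.
have one0 : 0 <= 1 :> R by [].
have y10 : 0 <= 2 * y - 1 by lra.
have n0 k : 0 <= k%:R :> R by [].
have two0 : 0 <= 2 :> R by [].
have ym0 : 0 <= y - 1 by lra.
have x0 : 0 <= x by lra.
have y0 : 0 <= y by lra.
have sx0 : 0 <= 1 + x by lra.
have reduce v k : 0 <= (1 + x) * ((1 + y * x * theta) * v + (1 + x * theta) * (2 * y - gR k)) ->
    gR k <= profile theta * v + 2 * y.
  rewrite pmulr_rge0 => [h|]; last lra.
  rewrite -lerBlDr /profile mulrAC ler_pdivlMr// -/x -/y; lra.
case: (leP (t * (1 + x)) (x * S%:R * (1 + x * theta))) => [c1|c1].
  exists t, (Num.truncn t).+1; have t0 : 0 <= t by lra.
  have /andP[nt tn] := truncn_itv t0.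
  have Sk : (S <= (Num.truncn t).+1)%N by rewrite leqW// truncn_ge_nat.
  split=> //; [by rewrite ger_pMr//; lra | exact: ltW | apply: reduce].
  have /andP[_] := up _ Sk; set k := _.+1; move=> ub.
  have kt : k%:R <= t + 1 by rewrite -natr1 lerD2r.
  have ub0 : 0 <= gR S + y * (k%:R - S%:R) - gR k by lra.
  have kt0 : 0 <= t + 1 - k%:R by lra.
  have c10 : 0 <= x * S%:R * (1 + x * theta) - t * (1 + x) by lra.
  have -> : (1 + x) * ((1 + y * x * theta) * t + (1 + x * theta) * (2 * y - gR k)) =
    (y - 1) * (x * S%:R * (1 + x * theta) - t * (1 + x)) +
    (1 + x) * (1 + x * theta) * (gR S + y * (k%:R - S%:R) - gR k) +
    (1 + x) * (1 + x * theta) * y * (t + 1 - k%:R) +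
    (1 + x * theta) * (y + x) +
    (1 + x * theta) * ((x + y) * S%:R + x * (y - 1) - (1 + x) * gR S) by ring.
  rewrite eqG subrr mulr0 addr0; nneg.
case: (ltP t (S'%:R * theta)) => [c2|c2].
  have v0 : 0 <= t / theta by rewrite divr_ge0; lra.
  have /andP[nt tn] := truncn_itv v0.
  exists (t / theta), (Num.truncn (t / theta)).+1.
  have kS : ((Num.truncn (t / theta)).+1 <= S')%N.
    by rewrite truncn_lt_nat// ltr_pdivrMr.
  have tv : t / theta * theta = t by rewrite divfK ?gt_eqF.
  split; [ | by rewrite tv | exact: ltW | apply: reduce].
    by rewrite ler_pdivlMr// ger_pMr//; lra.
  have /andP[lb _] := up' _ kS; move: lb; set k := _.+1 => lb.
  have kt : k%:R <= t / theta + 1 by rewrite -natr1 lerD2r.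
  move: tv kt {nt tn kS v0}; set v := t / theta; move=> tv kt.
  have lb0 : 0 <= gR S' - (gR k + (S'%:R - k%:R)) by lra.
  have kt0 : 0 <= v + 1 - k%:R by lra.
  have c10 : 0 <= t * (1 + x) - x * S%:R * (1 + x * theta) by lra.
  have -> : (1 + x) * ((1 + y * x * theta) * v + (1 + x * theta) * (2 * y - gR k)) =
    (y - 1) * x * (v * theta * (1 + x) - x * S%:R * (1 + x * theta)) +
    (1 + x) * (1 + x * theta) * (gR S' - (gR k + (S'%:R - k%:R))) +
    (1 + x) * (1 + x * theta) * (v + 1 - k%:R) +
    (1 + x * theta) * (x * y + (2 * y - 1)) +
    (1 + x * theta) * ((x + y) * S'%:R + x * (y - 1) - (1 + x) * gR S').
    by rewrite eqS'; ring.
  rewrite eqG' subrr mulr0 addr0 tv; nneg.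
exists S'%:R, S'; split=> //; [exact: ltW | apply: reduce].
have -> : (1 + x) * ((1 + y * x * theta) * S'%:R + (1 + x * theta) * (2 * y - gR S')) =
    (y - 1) * (theta * x ^+ 2 - 1) * S'%:R +
    (1 + x * theta) * (x * y + 2 * y + x) +
    (1 + x * theta) * ((x + y) * S'%:R + x * (y - 1) - (1 + x) * gR S').
  by ring.
have th0x : 0 <= theta * x ^+ 2 - 1 by lra.
rewrite eqG' subrr mulr0 addr0; nneg; exact: n0.
Qed.

(** At theta = 1 / L^2 the profile is the asymptotic minimum
    (L + m) / (1 + L). *)
Lemma count_exponent_min j : gR (L ^ j.*2) <= profile (1 / L%:R ^+ 2) * (L ^ j.*2)%:R + m%:R.
Proof.
have x2 := L2; have y1 := m1.
have := pow_even j; set x := L%:R in x2 *; set y := m%:R in y1 *; set S := (_%:R in RHS).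
rewrite -/x -/y => eqG.
have -> : profile (1 / x ^+ 2) = (x + y) / (1 + x).
  by rewrite /profile -/x -/y; field; do ?(apply/andP; split); lra.
rewrite -(@ler_pM2l _ (1 + x)); last lra.
have sx : 1 + x != 0 by rewrite gt_eqF//; lra.
rewrite eqG; have -> : (1 + x) * ((x + y) / (1 + x) * S + y) = (x + y) * S + (1 + x) * y.
  by field.
by rewrite lerD2l; lra.
Qed.

(** For theta = 1 / L^2 the critical windows are [L^(2j), L^(2j+2)], and these
    cover all levels. *)
Lemma count_exponent_global k : (1 <= k)%N -> profile (1 / L%:R ^+ 2) * k%:R <= gR k.
Proof.
have x2 := L2; have y1 := m1.
move=> k1; have [j] := pow_bracket k%:R ltac:(by rewrite ler1n).
have th0 : 0 < 1 / L%:R ^+ 2 :> R by rewrite divr_gt0// exprn_gt0//; lra.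
have th1 : 1 / L%:R ^+ 2 <= 1 :> R.
  by rewrite ler_pdivrMr ?mul1r ?exprn_ege1 ?exprn_gt0//; lra.
move=> /andP[lo hi].
have := count_exponent_lower (1 / L%:R ^+ 2) 0 j k; rewrite th0 th1 !mulr0 subr0 addr0.
have -> : (L ^ j.*2.+1)%:R = L%:R * (L ^ j.*2)%:R :> R by rewrite -!natrM -!expnS.
move: hi; have -> : (L ^ j.*2.+2)%:R = L%:R * (L%:R * (L ^ j.*2)%:R) :> R by rewrite -!natrM -!expnS.
move: lo th0 th1; set x := L%:R in x2 *; set S := (_ ^ _)%:R => lo th0 th1 hi.
have xV : x * (1 / x ^+ 2) = x^-1 by field; lra.
have xx : x * x^-1 = 1 by rewrite divff//; lra.
apply=> //.
  rewrite xV mulrDr mulr1 mulrAC xx mul1r; rewrite (mulrDr k%:R) mulr1 addrC lerD//.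
  by rewrite mulrC ler_wpM2r//; lra.
have -> : (k%:R - 1) * (1 / x ^+ 2) * (1 + x) = (k%:R - 1) * x^-1 * (1 + x^-1) by field; lra.
rewrite xV; rewrite ler_wpM2r//; first by rewrite addr_ge0// invr_ge0; lra.
by rewrite ler_pdivrMr; lra.
Qed.

End Profile.
End Counting.

(** * Segments of the line *)

Section Intervals.
Variable R : realType.
Implicit Types (a r : R).

Definition segment1 a r : set 'rV[R]_1 := [set x | a <= x ord0 ord0 <= a + r].

Lemma edist1 (x y : 'rV[R]_1) : edist x y = `|x ord0 ord0 - y ord0 ord0|.
Proof. by rewrite /edist big_ord1 sqrtr_sqr. Qed.

Lemma edist_le_diam d (A : set 'rV[R]_d) x y : A x -> A y ->
  ((edist x y)%:E <= diam A)%E.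
Proof. by move=> Ax Ay; apply: ereal_sup_ubound; right; exists (x, y). Qed.

Lemma diam_ge0 d (A : set 'rV[R]_d) : (0 <= diam A)%E.
Proof. by apply: ereal_sup_ubound; left. Qed.

Lemma diam_segment1 a r : 0 <= r -> diam (segment1 a r) = r%:E.
Proof.
move=> r0; apply/eqP; rewrite eq_le; apply/andP; split.
  apply: ge_ereal_sup => _ [->|[[x y] [/= /andP[x1 x2] /andP[y1 y2]] <-]].
    by rewrite lee_fin.
  by rewrite lee_fin edist1 ler_norml; apply/andP; split; lra.
rewrite -[r in r%:E]ger0_norm//.
have -> : `|r| = edist (const_mx (a + r) : 'rV[R]_1) (const_mx a) by rewrite edist1 !mxE addrC addKr.
by apply: edist_le_diam; rewrite /segment1/= !mxE; apply/andP; split; lra.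
Qed.

Lemma compact_segment1 a r : compact (segment1 a r).
Proof.
have -> : segment1 a r = [set v | forall i : 'I_1, `[a, a + r]%classic (v ord0 i)].
  apply/seteqP; split=> x /=; first by move=> h i; rewrite (ord1 i) in_itv; exact: h.
  by move=> /(_ ord0); rewrite in_itv.
apply: (@rV_compact R 1 (fun=> `[a, a + r]%classic)) => _; exact: segment_compact.
Qed.

Lemma closed_segment1 a r : closed (segment1 a r).
Proof. by apply: compact_closed; [exact: norm_hausdorff | exact: compact_segment1]. Qed.

Lemma interior_segment1 a r : 0 < r -> (segment1 a r)° !=set0.
Proof.
move=> r0; exists (const_mx (a + r / 2)).
have sub : (fun x : 'rV[R]_1 => x ord0 ord0) @^-1` `]a, a + r[%classic
    `<=` segment1 a r.
  by move=> x; rewrite /segment1 /= in_itv/= => /andP[/ltW-> /ltW->].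
apply: filterS sub _; apply: open_nbhs_nbhs; split.
  by apply: open_comp => [x _|]; [exact: coord_continuous | exact: interval_open].
by rewrite /= mxE in_itv/=; apply/andP; split; lra.
Qed.

(** The map x |-> b + r x carries a segment of length 1 to one of length r. *)
Lemma similarity_segment1 a b r : 0 < r ->
  exists Psi : 'rV[R]_1 -> 'rV[R]_1, similarity Psi /\ segment1 (b + r * a) r = Psi @` segment1 a 1.
Proof.
move=> r0; exists (fun x => const_mx b + r *: x); split.
  exists r; split=> // x y; rewrite !edist1 !mxE.
  by rewrite -[r in RHS]gtr0_norm// -normrM; congr `|_|; ring.
apply/seteqP; split=> [x /= /andP[x1 x2]|_ [x /andP[x1 x2] <-]].
  exists (r^-1 *: (x - const_mx b)).
    rewrite /segment1 /= !mxE mulrC ler_pdivlMr// ler_pdivrMr//; apply/andP; split; lra.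
  by rewrite scalerA divff ?gt_eqF// scale1r addrC subrK.
by rewrite /segment1 /= !mxE; apply/andP; split; nra.
Qed.
End Intervals.

(** * Equally spaced Moran sets on the line *)

Section LineMoran.
Variables (R : realType) (n : nat -> nat) (rho q : R).

Definition word_count (k : nat) : nat := (\prod_(j < k) n j.+1)%N.

(** The children of an interval of length rho^k start at the offsets
    rho^k q i; the letters of a word start at 1. *)
Definition word_pos (u : seq nat) : R :=
  \sum_(j < size u) rho ^+ j * q * (nth 0%N u j).-1%:R.

Definition basic_set (u : seq nat) : set 'rV[R]_1 :=
  segment1 R (word_pos u) (rho ^+ size u).

Definition moran_limit : set 'rV[R]_1 :=
  \bigcap_(k in [set k | (1 <= k)%N]) \bigcup_(u in words n k) basic_set u.

(** Mixed radix expansion: a bijection from the naturals below word_count k to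
    the words of length k.  It serves to enumerate covers by naturals and to
    code the points of the limit set by real numbers. *)
Fixpoint word_of_rank (k p : nat) : seq nat :=
  if k is k'.+1 then
    rcons (word_of_rank k' (p %/ n k'.+1)) (p %% n k'.+1).+1
  else [::].

Hypothesis n_ge2 : forall k, (1 <= k)%N -> (2 <= n k)%N.
Hypothesis rho_gt0 : 0 < rho.
Hypothesis rho_lt_q : rho < q.
Hypothesis nq_le1 : forall k, (1 <= k)%N -> (n k)%:R * q <= 1.

Let n_gt0 k : (0 < n k.+1)%N.
Proof. by have := n_ge2 k.+1 isT; lia. Qed.

Let q_lt1 : q < 1.
Proof.
have /= := nq_le1 1 isT; have : 2 <= (n 1)%:R :> R by rewrite ler_nat n_ge2.
have := rho_lt_q; have := rho_gt0; nra.
Qed.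

Let rho_lt1 : rho < 1. Proof. exact: lt_trans q_lt1. Qed.

Let rhoX_gt0 k : 0 < rho ^+ k. Proof. exact: exprn_gt0. Qed.

Lemma word_countS k : word_count k.+1 = (word_count k * n k.+1)%N.
Proof. by rewrite /word_count big_ord_recr. Qed.

Lemma word_count_ge k : (2 ^ k <= word_count k)%N.
Proof.
elim: k => [|k IH]; first by rewrite /word_count big_ord0.
by rewrite word_countS expnSr leq_mul// n_ge2.
Qed.

Let word_count_gt0 k : (0 < word_count k)%N.
Proof. by apply: leq_trans (word_count_ge k); rewrite expn_gt0. Qed.

Lemma size_word_of_rank k p : size (word_of_rank k p) = k.
Proof. by elim: k p => //= k IH p; rewrite size_rcons IH. Qed.

Lemma words_rcons k u i :
  words n k.+1 (rcons u i) <-> words n k u /\ (1 <= i <= n k.+1)%N.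
Proof.
split=> [[/eqP]|[[su uP] iP]].
  rewrite size_rcons eqSS => /eqP su uP; split; last first.
    by have := uP k (ltnSn k); rewrite nth_rcons su ltnn eqxx.
  split=> // j jk; have := uP j (ltnW jk).
  by rewrite nth_rcons su jk.
split=> [|j]; first by rewrite size_rcons su.
rewrite ltnS leq_eqVlt nth_rcons su => /orP[/eqP->|jk].
  by rewrite ltnn eqxx.
by rewrite jk; exact: uP.
Qed.

Lemma words_of_rank k p : (p < word_count k)%N -> words n k (word_of_rank k p).
Proof.
elim: k p => [|k IH] p pN; first by split.
apply/words_rcons; split; last by rewrite /= ltn_mod n_gt0.
by apply: IH; rewrite ltn_divLR// -word_countS.
Qed.

Lemma words_rank k u : words n k u ->
  exists2 p, (p < word_count k)%N & u = word_of_rank k p.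
Proof.
elim: k u => [|k IH] u; first by case=> /size0nil -> _; exists 0%N.
case/lastP: u => [[]//|u i] /words_rcons[/IH[p pN ->] /andP[i1 iN]].
have iN' : (i.-1 < n k.+1)%N by lia.
exists (p * n k.+1 + i.-1)%N.
  by rewrite word_countS; move: (word_count k) pN => N pN; nia.
rewrite /= divnMDl// (divn_small iN') addn0 modnMDl modn_small//.
by rewrite prednK.
Qed.

Lemma word_pos_rcons u i :
  word_pos (rcons u i) = word_pos u + rho ^+ size u * q * i.-1%:R.
Proof.
rewrite /word_pos size_rcons big_ord_recr/= nth_rcons ltnn eqxx.
by congr (_ + _); apply: eq_bigr => j _; rewrite nth_rcons ltn_ord.
Qed.

Lemma offset_le k i : (1 <= i <= n k.+1)%N -> i.-1%:R * q <= 1 - rho.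
Proof.
move=> /andP[i1 iN]; have := nq_le1 k.+1 isT.
have : i%:R * q <= (n k.+1)%:R * q by apply: ler_wpM2r; [exact: ltW (lt_trans rho_gt0 rho_lt_q) | rewrite ler_nat].
have -> : i%:R = i.-1%:R + 1 :> R by rewrite natr1 prednK.
have := rho_lt_q; lra.
Qed.

Lemma basic_set_sub k u i : words n k u -> (1 <= i <= n k.+1)%N ->
  basic_set (rcons u i) `<=` basic_set u.
Proof.
have q0 : 0 <= q by apply/ltW/(lt_trans rho_gt0).
move=> [su _] iP x; rewrite /basic_set /segment1/= word_pos_rcons size_rcons su.
have := offset_le _ _ iP; set j := i.-1%:R => jq /andP[x1 x2].
have j0 : 0 <= j by [].
have r0 := rhoX_gt0 k.
have o0 : 0 <= rho ^+ k * q * j by rewrite !mulr_ge0//; lra.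
have : rho ^+ k * (j * q) <= rho ^+ k * (1 - rho) by rewrite ler_wpM2l// ltW.
rewrite exprS in x2; rewrite mulrBr => le; apply/andP; split; lra.
Qed.

(** The children themselves, and not just their interiors, are disjoint, since
    the spacing q exceeds the ratio rho. *)
Lemma basic_set_disjoint k u : words n k u ->
  trivIset [set i | (1 <= i <= n k.+1)%N] (fun i => basic_set (rcons u i)).
Proof.
have q0 : 0 <= q by apply/ltW/(lt_trans rho_gt0).
move=> [su _] i j.
wlog ij : i j / (i <= j)%N => [wl iP jP|].
  by case/orP: (leq_total i j) => h; [|rewrite setIC => xx; apply/esym; move: xx]; exact: wl.
move=> /andP[i1 _] _ [x []]; rewrite /basic_set /segment1/= !word_pos_rcons !size_rcons su.
move=> /andP[x1 x2] /andP[x3 x4]; apply/eqP; rewrite eqn_leq ij/= leqNgt; apply/negP => ltij.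
have : i.-1%:R + 1 <= j.-1%:R :> R by rewrite natr1 ler_nat; lia.
rewrite exprS in x2; set a := i.-1%:R in x2 *; set b := j.-1%:R in x3 * => ab.
have r0 := rhoX_gt0 k.
have : rho ^+ k * q * (a + 1) <= rho ^+ k * q * b.
  by rewrite ler_wpM2l// mulr_ge0; lra.
have : rho ^+ k * rho < rho ^+ k * q by rewrite ltr_pM2l.
lra.
Qed.

Lemma basic_set_root k u : words n k u -> basic_set u `<=` basic_set [::].
Proof.
elim: k u => [|k IH] u; first by case=> /size0nil -> _ x.
case/lastP: u => [[]//|u i] /words_rcons[uP iP].
exact: subset_trans (basic_set_sub _ _ _ uP iP) (IH _ uP).
Qed.

Lemma diam_basic_set u : diam (basic_set u) = (rho ^+ size u)%:E.
Proof. by rewrite diam_segment1// exprn_ge0// ltW. Qed.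

Lemma line_moran_structure :
  moran_structure n (fun=> rho) (basic_set [::]) basic_set.
Proof.
have pos0 : word_pos [::] = 0 by rewrite /word_pos big_ord0.
split=> //.
- by move=> k k1; rewrite expr1; apply: le_trans (nq_le1 k k1); rewrite ler_wpM2l// ltW.
- exact: compact_segment1.
- exact: interior_segment1.
- by move=> k u uP; split; [exact: closed_segment1 | exact: basic_set_root uP].
- move=> k u uP; rewrite /basic_set pos0 expr0.
  have -> : word_pos u = word_pos u + rho ^+ size u * 0 by rewrite mulr0 addr0.
  exact: similarity_segment1.
- exact: basic_set_sub.
- move=> k u uP i j iP jP [x [xi xj]]; apply: (basic_set_disjoint k u uP i j iP jP).
  by exists x; split; exact: interior_subset.
- move=> k u i [su _] iP; rewrite !diam_basic_set size_rcons/= exprSr.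
  by rewrite mulrAC divff ?mul1r// gt_eqF.
Qed.

Lemma homogeneous_moran_limit : homogeneous_moran_set moran_limit.
Proof.
by exists n, (fun=> rho), (basic_set [::]), basic_set; split=> //; exact: line_moran_structure.
Qed.

(** The intervals of level k are lengthened to a common diameter r, which may
    be any admissible diameter above rho^k. *)
Lemma moran_limit_cover (theta s eps delta r : R) (k : nat) : (1 <= k)%N ->
  lower_scale theta delta <= r <= delta -> rho ^+ k <= r ->
  (word_count k)%:R * r `^ s <= eps ->
  has_theta_cover theta s eps delta moran_limit.
Proof.
move=> k1 rr rk sum_le; have r0 : 0 <= r by apply: le_trans rk; apply/ltW.
pose U p := segment1 R (word_pos (word_of_rank k p)) r.
have dU p : diam (U p) = r%:E by rewrite diam_segment1.
exists `I_(word_count k), U; split.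
- move=> x /(_ k k1) [u /words_rank[p pN ->]] ux; exists p => //.
  move: ux; rewrite /basic_set /U /segment1/= size_word_of_rank => /andP[-> h] /=.
  by apply: le_trans h _; rewrite lerD2l.
- by move=> p _; rewrite dU !lee_fin.
- rewrite /diam_sum; under eq_esum do rewrite dU poweR_EFin.
  rewrite esum_fset//; last by move=> p _; rewrite lee_fin powR_ge0.
  rewrite -fsbig_ord sumEFin sumr_const card_ord lee_fin.
  by rewrite -mulr_natl.
Qed.

(** Distinct intervals of level k are separated by a gap of at least
    (q - rho) rho^(k-1).  Siblings are q rho^(k-1) apart; the children of
    distinct parents inherit the larger gap between the parents.  For k = 0
    there is only one interval. *)
Lemma word_pos_separated k p p' :
  (p < word_count k)%N -> (p' < word_count k)%N -> p != p' ->
  rho ^+ k + (q - rho) * rho ^+ k.-1 <=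
    `|word_pos (word_of_rank k p) - word_pos (word_of_rank k p')|.
Proof.
elim: k p p' => [|k IH] p p' pN p'N neq.
  by move: pN p'N neq; rewrite /word_count big_ord0 !ltnS !leqn0 => /eqP-> /eqP->.
have lt_div r : (r < word_count k.+1)%N -> (r %/ n k.+1 < word_count k)%N.
  by rewrite word_countS ltn_divLR.
have offset r : 0 <= rho ^+ k * q * (r %% n k.+1)%:R <= rho ^+ k * (1 - rho).
  have q0 : 0 <= q by apply/ltW/(lt_trans rho_gt0).
  apply/andP; split; first by rewrite !mulr_ge0// ltW.
  rewrite -mulrA ler_pM2l// mulrC; apply: (@offset_le k (r %% n k.+1).+1).
  by rewrite /= ltn_mod.
rewrite /= !word_pos_rcons !size_word_of_rank [rho ^+ k.+1]exprS.
have [eqd|neqd] := eqVneq (p %/ n k.+1)%N (p' %/ n k.+1)%N.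
  have neqm : (p %% n k.+1 != p' %% n k.+1)%N.
    by apply: contraNneq neq => eqm; rewrite (divn_eq p (n k.+1)) eqd eqm -divn_eq.
  rewrite eqd; set a := (p %% _)%N in neqm *; set b := (p' %% _)%N in neqm *.
  have -> (z : R) : z + rho ^+ k * q * a.+1.-1%:R - (z + rho ^+ k * q * b.+1.-1%:R) =
      rho ^+ k * q * (a%:R - b%:R) by rewrite /=; ring.
  have rq0 : 0 < rho ^+ k * q by rewrite mulr_gt0// (lt_trans rho_gt0).
  rewrite normrM (gtr0_norm rq0).
  have -> : rho * rho ^+ k + (q - rho) * rho ^+ k = rho ^+ k * q by ring.
  rewrite ler_peMr//; first exact: ltW.
  move: neqm; rewrite neq_ltn => /orP[]; rewrite -(ler_nat R) -natr1 => ab.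
    by rewrite ltr0_norm; lra.
  by rewrite gtr0_norm; lra.
have := IH _ _ (lt_div _ pN) (lt_div _ p'N) neqd.
have := offset p; have := offset p'; rewrite /=.
set x := word_pos _; set y := word_pos _.
set b := _ * _%:R; set a := _ * _%:R => /andP[b0 b1] /andP[a0 a1] IHk.
have : (q - rho) * rho ^+ k <= (q - rho) * rho ^+ k.-1.
  rewrite ler_pM2l ?subr_gt0//; case: (k) => //= k'.
  by rewrite exprS ger_pMl// ltW.
rewrite mulrBr mulr1 [rho ^+ k * rho]mulrC in a1 b1.
have : `|x - y| <= `|x + a - (y + b)| + `|b - a|.
  by apply: le_trans (ler_normD _ _); rewrite le_eqVlt; apply/orP; left; apply/eqP; congr `|_|; ring.
have : `|b - a| <= rho ^+ k - rho * rho ^+ k.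
  by rewrite ler_norml; apply/andP; split; lra.
lra.
Qed.

(** A number y in [0, 1) codes a point of the limit set: its interval of level
    k is the one whose rank is the integer part of y times the number of
    intervals.  Transporting Lebesgue measure along this coding gives the
    natural measure, under which all intervals of level k have equal mass. *)
Definition coding_rank (y : R) (k : nat) : nat := Num.truncn (y * (word_count k)%:R).

Lemma coding_rankP (y : R) (k : nat) : 0 <= y ->
  (coding_rank y k)%:R <= y * (word_count k)%:R < (coding_rank y k).+1%:R.
Proof. by move=> y0; apply: truncn_itv; rewrite mulr_ge0. Qed.

Lemma coding_rank_lt (y : R) (k : nat) : 0 <= y < 1 -> (coding_rank y k < word_count k)%N.
Proof.
move=> /andP[y0 y1]; rewrite truncn_lt_nat ?mulr_ge0//.
by rewrite gtr_pMl// ltr0n.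
Qed.

(** The expansions of the successive ranks extend one another. *)
Lemma coding_rank_div (y : R) (k : nat) : 0 <= y -> (coding_rank y k.+1 %/ n k.+1)%N = coding_rank y k.
Proof.
move=> y0; apply/esym/eqP; rewrite truncn_eq ?mulr_ge0//.
have /andP[] := coding_rankP y k.+1 y0; set a := coding_rank y k.+1.
rewrite word_countS natrM mulrA => lo hi.
have nR : 0 < (n k.+1)%:R :> R by rewrite ltr0n.
apply/andP; split.
  rewrite -(ler_pM2r nR); apply: le_trans lo; rewrite -natrM ler_nat.
  exact: leq_trunc_div.
rewrite -(ltr_pM2r nR); apply: lt_le_trans hi _; rewrite -natrM ler_nat.
exact: ltn_ceil.
Qed.

Definition coded_left (y : R) (k : nat) : R := word_pos (word_of_rank k (coding_rank y k)).

Lemma coded_leftS y k : 0 <= y ->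
  coded_left y k <= coded_left y k.+1 /\
  coded_left y k.+1 + rho ^+ k.+1 <= coded_left y k + rho ^+ k.
Proof.
move=> y0; rewrite /coded_left/= coding_rank_div// word_pos_rcons size_word_of_rank /=.
have q0 : 0 <= q by apply/ltW/(lt_trans rho_gt0).
split; first by rewrite lerDl !mulr_ge0// ltW.
have : rho ^+ k * ((coding_rank y k.+1 %% n k.+1)%:R * q) <= rho ^+ k * (1 - rho).
  rewrite ler_pM2l//; apply: (@offset_le k (coding_rank y k.+1 %% n k.+1).+1).
  by rewrite /= ltn_mod.
by rewrite exprS; lra.
Qed.

Lemma coded_left_nested y i j : 0 <= y -> coded_left y i <= coded_left y j + rho ^+ j.
Proof.
move=> y0; have lo d k : coded_left y k <= coded_left y (k + d).
  elim: d => [|d IH]; rewrite ?addn0// addnS; apply: le_trans IH _.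
  by have [] := coded_leftS y (k + d) y0.
have hi d k : coded_left y (k + d) + rho ^+ (k + d) <= coded_left y k + rho ^+ k.
  elim: d => [|d IH]; rewrite ?addn0// addnS; apply: le_trans IH.
  by have [] := coded_leftS y (k + d) y0.
apply: le_trans (hi i j); rewrite addnC; apply: le_trans (lo j i) _.
by rewrite lerDl ltW.
Qed.

(** The left ends increase and the right ends decrease, so the supremum of the
    left ends lies in all the coded intervals. *)
Definition coded_point (y : R) : 'rV[R]_1 := const_mx (sup (range (coded_left y))).

Lemma coded_point_basic y k : 0 <= y ->
  basic_set (word_of_rank k (coding_rank y k)) (coded_point y).
Proof.
move=> y0; rewrite /basic_set /segment1/= mxE size_word_of_rank -/(coded_left y k).
apply/andP; split.
  apply: ub_le_sup; last by exists k.
  by exists (coded_left y 0 + rho ^+ 0) => _ [i _ <-]; exact: coded_left_nested.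
by apply: ge_sup; [exists (coded_left y 0), 0%N | move=> _ [i _ <-]; exact: coded_left_nested].
Qed.

Lemma coded_point_limit y : 0 <= y < 1 -> moran_limit (coded_point y).
Proof.
move=> yP k _; exists (word_of_rank k (coding_rank y k)).
  exact: words_of_rank (coding_rank_lt _ _ yP).
by apply: coded_point_basic; case/andP: yP.
Qed.

(** By word_pos_separated, points closer than the gap between the intervals of
    level k + 1 cannot lie in two of them. *)
Lemma coded_point_separated y y' k : 0 <= y < 1 -> 0 <= y' < 1 ->
  edist (coded_point y) (coded_point y') < (q - rho) * rho ^+ k ->
  coding_rank y k.+1 = coding_rank y' k.+1.
Proof.
move=> yP y'P; rewrite edist1 => lt; apply/eqP; apply: contraLR lt => neq; rewrite -leNgt.
have := word_pos_separated k.+1 _ _ (coding_rank_lt _ _ yP) (coding_rank_lt _ _ y'P) neq.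
have /andP[y0 _] := yP; have /andP[y'0 _] := y'P.
have /andP[] := coded_point_basic y k.+1 y0; have /andP[] := coded_point_basic y' k.+1 y'0.
rewrite !size_word_of_rank /=; set a := word_pos _; set b := word_pos _.
set u : R := coded_point y _ _; set v : R := coded_point y' _ _; set r := rho ^+ k.+1.
move=> *; apply: (@le_trans _ _ (`|b - a| - r)); first by lra.
rewrite lerBlDr; case: (ger0P (b - a)) => _.
  have : u - v <= `|u - v| by exact: ler_norm.
  by lra.
have : v - u <= `|u - v| by rewrite distrC; exact: ler_norm.
by lra.
Qed.

(** Mass distribution principle.  The codes of the points of U i lie in an
    interval of length 1 / word_count k.+1, or in a single point when the
    diameter is 0.  As the U i cover the limit set, these intervals cover
    [0, 1), and the countable subadditivity of Lebesgue measure concludes. *)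
Lemma mass_distribution (C s : R) (D : set nat) (U : nat -> set 'rV[R]_1) :
  0 <= C -> cover_of moran_limit D U ->
  (forall i, D i -> diam (U i) = 0%E \/
     exists k r, [/\ diam (U i) = r%:E, r < (q - rho) * rho ^+ k &
                    (word_count k.+1)%:R^-1 <= C * r `^ s]) ->
  (1 <= C%:E * diam_sum s D U)%E.
Proof.
move=> C0 cov small.
pose coded i := [set y | 0 <= y < 1 /\ U i (coded_point y)].
have a_ge0 i : (0 <= diam (U i) `^ s)%E by exact: poweR_ge0.
have : forall i, exists A : set R, [/\ measurable A, D i -> coded i `<=` A &
    (lebesgue_measure A <= if i \in D then C%:E * diam (U i) `^ s else 0)%E].
  move=> i; have [iD|iD] := pselect (D i); last first.
    by exists set0; rewrite measure0 memNset.
  rewrite mem_set//; have [[y0 [y0P Uy0]]|no] := pselect (coded i !=set0); last first.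
    exists set0; rewrite measure0; split=> //.
      by move=> _ y cy; apply: no; exists y.
    by rewrite mule_ge0.
  have same k r : diam (U i) = r%:E -> r < (q - rho) * rho ^+ k ->
      forall y, coded i y -> coding_rank y k.+1 = coding_rank y0 k.+1.
    move=> dr rk y [yP Uy]; apply: coded_point_separated => //.
    by apply: le_lt_trans rk; rewrite -lee_fin -dr; exact: edist_le_diam.
  have [d0|[k [r [dr rk NC]]]] := small i iD.
    exists [set y0]; rewrite lebesgue_measure_set1; split=> //; last by rewrite mule_ge0.
    (* Points at distance 0 have the same rank at all levels, so their codes
       differ by at most 1 / word_count k for all k. *)
    move=> _ y cy /=; have {}same k : coding_rank y k.+1 = coding_rank y0 k.+1.
      by apply: (same k 0) => //; rewrite mulr_gt0// subr_gt0.
    have /andP[yge _] := cy.1; have /andP[y0ge _] := y0P.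
    have bound k : `|y - y0| * k.+1%:R <= 1.
      have N0 : 0 < (word_count k.+1)%:R :> R by rewrite ltr0n.
      apply: (@le_trans _ _ (`|y - y0| * (word_count k.+1)%:R)).
        rewrite ler_wpM2l// ler_nat; apply: leq_trans (word_count_ge _).
        exact/ltnW/ltn_expl.
      rewrite -[X in _ * X]gtr0_norm// -normrM mulrBl.
      have /andP[] := coding_rankP y k.+1 yge; have /andP[] := coding_rankP y0 k.+1 y0ge.
      rewrite same -natr1 => ? ? ? ?; rewrite ler_norml; apply/andP; split; lra.
    apply/eqP; rewrite -subr_eq0 -normr_eq0; apply/negPn/negP => nz.
    have pos : 0 < `|y - y0| by rewrite lt_def nz normr_ge0.
    have := bound (Num.truncn `|y - y0|^-1); rewrite leNgt => /negP; apply.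
    by rewrite -ltr_pdivrMl// mulr1 truncnS_gt.
  have N0 : 0 < (word_count k.+1)%:R :> R by rewrite ltr0n.
  pose p := coding_rank y0 k.+1.
  exists `[p%:R / (word_count k.+1)%:R, p.+1%:R / (word_count k.+1)%:R[%classic.
  split=> [//|_ y cy|].
    rewrite /= in_itv/= ler_pdivrMr// ltr_pdivlMr//.
    by rewrite /p -(same k r dr rk y cy); apply: coding_rankP; case/andP: cy.1.
  rewrite lebesgue_measure_itv/= lte_fin ltr_pM2r ?invr_gt0// ltr_nat ltnSn.
  rewrite -EFinD -mulrBl -natrB// subSnn mul1r dr poweR_EFin -EFinM lee_fin.
  exact: NC.
move=> /choice[A AP].
have : (lebesgue_measure `[0%R, 1%R[%classic <= \sum_(0 <= i <oo) lebesgue_measure (A i : set R))%E.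
  apply: measure_sigma_subadditive => //; first by move=> i; have [] := AP i.
  move=> y; rewrite /= in_itv/= => yP.
  have [i iD Ui] := cov _ (coded_point_limit y yP).
  by exists i => //; have [_ sub _] := AP i; apply: sub.
rewrite lebesgue_measure_itv/= lte_fin ltr01 oppr0 adde0 => le1.
have -> : diam_sum s D U = (\sum_(0 <= i <oo | i \in D) (diam (U i) `^ s))%E.
  by rewrite nneseries_esum// set_mem_set.
rewrite -nneseriesZl// eseries_mkcond; apply: le_trans le1 _.
by apply: lee_nneseries => i // _; have [] := AP i.
Qed.

End LineMoran.

(** * Inequalities between the dimensions *)

Section Comparison.
Variables (R : realType) (d : nat).
Implicit Types (E : set 'rV[R]_d) (theta s eps delta : R).

(** For delta <= 1, decreasing theta only enlarges the range of admissible
    diameters. *)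
Lemma lower_scale_le theta theta' delta : 0 <= theta <= theta' -> 0 < delta <= 1 ->
  lower_scale theta delta <= lower_scale theta' delta.
Proof.
move=> /andP[th0 thth'] deltaP; rewrite /lower_scale.
have [_|nz] := eqVneq theta 0; first by case: ifP => // _; exact: powR_ge0.
have th_gt0 : 0 < theta by rewrite lt_neqAle eq_sym nz.
have th'_gt0 := lt_le_trans th_gt0 thth'.
by rewrite gt_eqF// ger_powR// lef_pV2.
Qed.

Lemma has_theta_cover_le theta theta' s eps delta E :
  0 <= theta <= theta' -> 0 < delta <= 1 ->
  has_theta_cover theta' s eps delta E -> has_theta_cover theta s eps delta E.
Proof.
move=> thP dP [D [U [cov diam_itv sum]]]; exists D, U; split=> // i iD.
have /andP[lo ->] := diam_itv i iD; rewrite andbT; apply: le_trans lo.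
by rewrite lee_fin lower_scale_le.
Qed.

Lemma upper_intermediate_dim_le theta theta' E : 0 <= theta <= theta' ->
  (upper_intermediate_dim theta E <= upper_intermediate_dim theta' E)%E.
Proof.
move=> thP; apply: ereal_inf_le_tmp => _ [s [s0 sP] <-]; exists s => //; split=> // eps e0.
have [Delta [D0 cov]] := sP eps e0.
exists (Num.min Delta 1); split; first by rewrite lt_min D0 ltr01.
move=> delta /andP[d0]; rewrite le_min => /andP[dD d1].
by apply: (has_theta_cover_le _ _ _ _ _ _ thP); rewrite ?d0//; apply: cov; rewrite d0.
Qed.

Lemma lower_le_upper_intermediate_dim theta E :
  (lower_intermediate_dim theta E <= upper_intermediate_dim theta E)%E.
Proof.
apply: ereal_inf_le_tmp => _ [s [s0 sP] <-]; exists s => //; split=> // eps Delta0 e0 D0.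
have [Delta [D1 cov]] := sP eps e0.
have m0 : 0 < Num.min Delta0 Delta by rewrite lt_min D0 D1.
exists (Num.min Delta0 Delta); split; first by rewrite m0 ge_min lexx.
by apply: cov; rewrite m0 ge_min lexx orbT.
Qed.

Lemma diam_sum_ge0 s D (U : nat -> set 'rV[R]_d) : (0 <= diam_sum s D U)%E.
Proof. by apply: esum_ge0 => i _; exact: poweR_ge0. Qed.

Lemma hausdorff_le_lower_intermediate_dim theta E :
  (hausdorff_dim E <= lower_intermediate_dim theta E)%E.
Proof.
apply: ereal_inf_le_tmp => _ [s [s0 sP] <-]; exists s => //; split=> //.
apply/eqP; rewrite eq_le; apply/andP; split.
  apply: ge_ereal_sup => _ [x x0 <-]; apply/lee_addgt0Pr => eps e0; rewrite add0e.
  have [delta [/andP[_ dx] [D [U [cov diam_itv sum]]]]] := sP eps x e0 x0.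
  apply: le_trans sum; apply: ereal_inf_lbound; exists D, U; split=> // i iD.
  by have /andP[_ h] := diam_itv i iD; apply: le_trans h _; rewrite lee_fin.
apply: (@le_trans _ _ (hausdorff_premeasure s 1 E)).
  by apply: le_ereal_inf_tmp => _ [D [U [_ _ ->]]]; exact: diam_sum_ge0.
by apply: ereal_sup_ubound; exists 1 => //; exact: ltr01.
Qed.

End Comparison.

(** * The Moran set with alternating blocks *)

(** With the spacing 2^-m, up to 2^m children fit into an interval, and the gaps
    between them are positive when m < gamma. *)
Definition block_moran_set (R : realType) (L m : nat) (gamma : R) : set 'rV[R]_1 :=
  moran_limit R (fun k => 2 ^ branching_exponent L m k.-1)%N
    (2 `^ (- gamma)) (2 `^ (- m%:R)).

Section BlockMoranSet.
Variables (R : realType) (L m : nat) (gamma : R).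
Hypotheses (L_ge2 : (2 <= L)%N) (m_ge1 : (1 <= m)%N) (m_lt_gamma : m%:R < gamma).

Let L_gt0 : (0 < L)%N. Proof. exact: ltnW. Qed.

Let n (k : nat) : nat := (2 ^ branching_exponent L m k.-1)%N.
Let rho : R := 2 `^ (- gamma).
Let q : R := 2 `^ (- m%:R).
Let E := block_moran_set R L m gamma.
Let g := count_exponent L m.
Let phi : R -> R := profile L m R.

Let le2 (x y : R) : (2 `^ x <= 2 `^ y) = (x <= y).
Proof.
by rewrite /powR gt_eqF ?ltr0n// ler_expR ler_pM2r// ln_gt0// ltr1n.
Qed.

Let le2_1 (x : R) : (2 `^ x <= 1) = (x <= 0).
Proof. by rewrite -[X in _ <= X](powRr0 2) le2. Qed.

Let rhoE (v : R) : rho `^ v = 2 `^ (- (gamma * v)).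
Proof. by rewrite -powRrM mulNr. Qed.

Let gamma_gt0 : 0 < gamma.
Proof. exact: le_lt_trans m_lt_gamma. Qed.

Let rho_gt0 : 0 < rho. Proof. by rewrite powR_gt0// ltr0n. Qed.

Let le_rho (x y : R) : (rho `^ x <= rho `^ y) = (y <= x).
Proof. by rewrite !rhoE le2 lerN2 ler_pM2l. Qed.

Let two_powD (x y : R) : 2 `^ (x + y) = 2 `^ x * 2 `^ y.
Proof. by rewrite powRD//; apply/implyP => _; rewrite pnatr_eq0. Qed.

Let rho_powD (x y : R) : rho `^ (x + y) = rho `^ x * rho `^ y.
Proof. by rewrite powRD//; apply/implyP => _; rewrite gt_eqF. Qed.

Let rhoX k : rho ^+ k = rho `^ k%:R.
Proof. by rewrite powR_mulrn// ltW. Qed.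

Let n_ge2 k : (1 <= k)%N -> (2 <= n k)%N.
Proof.
move=> _; rewrite /n -[X in (X <= _)%N]expn1 leq_exp2l//.
by case/andP: (branching_exponent_bounds L m m_ge1 k.-1).
Qed.

Let rho_lt_q : rho < q.
Proof. by rewrite ltNge /q /rho le2 lerN2 -ltNge. Qed.

Let nat2 (x : nat) : (2 ^ x)%:R = 2 `^ x%:R :> R.
Proof. by rewrite natrX powR_mulrn// ltW// ltr0n. Qed.

Let nq_le1 k : (1 <= k)%N -> (n k)%:R * q <= 1.
Proof.
move=> _; rewrite /n nat2 /q -two_powD.
rewrite le2_1 subr_le0 ler_nat.
by case/andP: (branching_exponent_bounds L m m_ge1 k.-1).
Qed.

Let word_countE k : (word_count n k)%:R = 2 `^ (g k)%:R :> R.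
Proof.
by rewrite -nat2; congr (_%:R); rewrite /word_count /g /count_exponent expn_sum.
Qed.

Lemma block_moran_homogeneous : homogeneous_moran_set E.
Proof. exact: homogeneous_moran_limit. Qed.

(* Scales are measured by their logarithm in base rho, the level. *)
Let level (x : R) : R := - ln x / (gamma * ln 2).

Let levelK (x : R) : 0 < x -> rho `^ (level x) = x.
Proof.
have l2 : 0 < ln 2 :> R by rewrite ln_gt0// ltr1n.
move=> x0; rewrite rhoE /powR gt_eqF ?ltr0n//.
have -> : - (gamma * level x) * ln 2 = ln x by rewrite /level; field; rewrite !gt_eqF.
by rewrite lnK// posrE.
Qed.

(* Half of the gap constant q - rho: the factor 2 turns the non-strict bound
   r <= kappa rho^k into the strict bound needed for separation. *)
Let kappa : R := (q - rho) / 2.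
Let K : R := level kappa.

Let kappa_gt0 : 0 < kappa.
Proof. by rewrite divr_gt0 ?subr_gt0 ?ltr0n. Qed.

Let kappaE : rho `^ K = kappa.
Proof. exact: levelK. Qed.

Let K_ge0 : 0 <= K.
Proof.
rewrite -le_rho kappaE powRr0 /kappa ler_pdivrMr ?ltr0n// mul1r.
have : q <= 1 by rewrite /q le2_1 oppr_le0.
by have := rho_gt0; lra.
Qed.

(* In logarithmic form: a cover by the intervals of level k, with diameters
   rho^v, is admissible if v lies in the window [t, t / theta] and v <= k. *)
Let cover_of_level (theta s eps t v : R) (k : nat) : 0 <= theta <= 1 -> (1 <= k)%N ->
  0 <= t <= v -> v * theta <= t -> v <= k%:R ->
  (g k)%:R - gamma * s * v <= ln eps / ln 2 -> 0 < eps ->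
  has_theta_cover theta s eps (rho `^ t) E.
Proof.
move=> /andP[th0 th1] k1 /andP[t0 tv] vt vk le_eps e0.
apply: (moran_limit_cover _ _ _ _ n_ge2 rho_gt0 rho_lt_q nq_le1 _ _ _ _ (rho `^ v) k) => //.
- rewrite le_rho tv andbT /lower_scale; case: eqP => [_|/eqP nz]; first exact: powR_ge0.
  by rewrite -powRrM le_rho ler_pdivlMr// lt_neqAle eq_sym nz.
- by rewrite rhoX le_rho.
have l2 : 0 < ln 2 :> R by rewrite ln_gt0// ltr1n.
rewrite word_countE -powRrM rhoE -two_powD.
have -> : eps = 2 `^ (ln eps / ln 2).
  by rewrite /powR gt_eqF ?ltr0n// divfK ?gt_eqF// lnK.
by rewrite le2; apply: le_trans le_eps; rewrite lerD2l lerN2 [v * s]mulrC mulrA.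
Qed.

Let profile_ge0 (theta : R) : 0 <= theta -> 0 <= phi theta.
Proof. by move=> th0; rewrite divr_ge0// addr_ge0// !mulr_ge0. Qed.

Let inv_sq_itv : 0 < 1 / (L%:R : R) ^+ 2 <= 1.
Proof.
have L0 : 0 < L%:R :> R by rewrite ltr0n.
have L1 : 1 <= L%:R :> R by rewrite ler1n.
by rewrite divr_gt0 ?exprn_gt0//= ler_pdivrMr ?mul1r ?exprn_ege1 ?exprn_gt0.
Qed.

(* An excess e of the exponent over psi / gamma makes the sum over a cover
   smaller than eps at all sufficiently deep levels v. *)
Let excess (eps e C v : R) : 0 < e -> (C - ln eps / ln 2) / (gamma * e) <= v ->
  forall psi, C + psi * v - gamma * (psi / gamma + e) * v <= ln eps / ln 2.
Proof.
move=> e0; rewrite ler_pdivrMr ?mulr_gt0// => le psi.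
have -> : C + psi * v - gamma * (psi / gamma + e) * v = C - v * (gamma * e).
  by field; rewrite gt_eqF.
lra.
Qed.

(** For an exponent above phi theta / gamma the cheap level found by
    count_exponent_upper in the window of each small scale gives the cover. *)
Lemma block_moran_upper_dim_le (theta : R) : 1 / L%:R ^+ 2 <= theta <= 1 ->
  (upper_intermediate_dim theta E <= (phi theta / gamma)%:E)%E.
Proof.
move=> /andP[th0 th1]; have /andP[i0 i1] := inv_sq_itv.
have th_gt0 : 0 < theta by exact: lt_le_trans i0 th0.
apply/lee_addgt0Pr => e e0; rewrite -EFinD; apply: ereal_inf_lbound.
exists (phi theta / gamma + e) => //; split.
  by apply: addr_ge0; [apply: divr_ge0; [apply: profile_ge0; exact: ltW | exact: ltW] | exact: ltW].
move=> eps eps0; pose t0 := Num.max 1 ((2 * m%:R - ln eps / ln 2) / (gamma * e)).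
exists (rho `^ t0); split=> [|delta /andP[d0]]; first exact: powR_gt0.
rewrite -{1}(levelK _ d0) le_rho ge_max => /andP[t1 te].
have thL : 1 <= theta * L%:R ^+ 2.
  by move: th0; rewrite ler_pdivrMr// exprn_gt0// ltr0n.
have [v [k [tv vt vk gk]]] := count_exponent_upper L m L_ge2 m_ge1 R theta _ thL th1 t1.
rewrite -(levelK _ d0); apply: (cover_of_level _ _ _ _ v k) => //.
- by rewrite th1 ltW.
- by rewrite -(ler1n R); apply: le_trans vk; apply: le_trans tv.
- by rewrite tv andbT (le_trans _ t1).
apply: le_trans (excess eps e _ v e0 (le_trans te tv) (phi theta)).
by rewrite lerD2r addrC.
Qed.

Let pow_unbounded (X w : R) (f : nat -> nat) : 0 < w -> (forall j, (j <= f j)%N) ->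
  exists j, X <= (L ^ f j)%:R * w.
Proof.
move=> w0 fP; exists (Num.truncn (X / w)); rewrite -ler_pdivrMr//.
apply: ltW; apply: lt_le_trans (truncnS_gt _) _; rewrite ler_nat.
set j := Num.truncn _; apply: (@leq_trans (L ^ j)); first exact: ltn_expl.
by rewrite leq_exp2l.
Qed.

(** The scales rho^(L^(2j)) are those at which the set has fewest intervals
    relative to the level,     and one may cover with diameters equal to the scale. *)
Lemma block_moran_lower_dim_le (theta : R) : 0 <= theta <= 1 ->
  (lower_intermediate_dim theta E <= (phi (1 / L%:R ^+ 2) / gamma)%:E)%E.
Proof.
move=> /andP[th0 th1]; have /andP[i0 i1] := inv_sq_itv; set th := 1 / L%:R ^+ 2 in i0 i1 *.
apply/lee_addgt0Pr => e e0; rewrite -EFinD; apply: ereal_inf_lbound.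
exists (phi th / gamma + e) => //; split.
  by apply: addr_ge0; [apply: divr_ge0; [apply: profile_ge0; exact: ltW | exact: ltW] | exact: ltW].
move=> eps Delta eps0 Delta0.
have [j] := pow_unbounded (Num.max (level Delta) ((m%:R - ln eps / ln 2) / (gamma * e)))
  1 double ltr01 ltac:(by move=> j; rewrite -addnn leq_addl).
rewrite mulr1 ge_max => /andP[tD te].
exists (rho `^ (L ^ j.*2)%:R); split.
  by rewrite powR_gt0//= -[leRHS](levelK _ Delta0) le_rho.
apply: (cover_of_level _ _ _ _ (L ^ j.*2)%:R (L ^ j.*2)) => //.
- by rewrite th0.
- by rewrite expn_gt0 L_gt0.
- by rewrite ler0n lexx.
- by rewrite ger_pMr// ltr0n expn_gt0 L_gt0.
apply: le_trans (excess eps e _ _ e0 te (phi th)).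
by rewrite lerD2r addrC; exact: count_exponent_min.
Qed.

(* The mass distribution principle in logarithmic form.  A diameter is
   written as kappa rho^t, and k is the integer part of t. *)
Let mass_le (s : R) (D : set nat) (U : nat -> set 'rV[R]_1) (B : R) :
  0 <= s -> cover_of E D U ->
  (forall i, D i -> diam (U i) = 0%E \/ exists t k, [/\ diam (U i) = (rho `^ (K + t))%:E,
     k%:R <= t < k.+1%:R & gamma * s * k.+1%:R - B <= (g k.+1)%:R ]) ->
  (1 <= (2 `^ B * rho `^ (- (K * s)))%:E * diam_sum s D U)%E.
Proof.
move=> s0 cov small; apply: (mass_distribution _ _ _ _ n_ge2 rho_gt0 rho_lt_q nq_le1 _ _ _ _ _ cov).
  by rewrite mulr_ge0// powR_ge0.
move=> i iD; have [?|[t [k [dU /andP[kt tk] gk]]]] := small i iD; [by left | right].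
exists k, (rho `^ (K + t)); split=> //.
  rewrite rho_powD kappaE rhoX.
  apply: (@le_lt_trans _ _ (kappa * rho `^ k%:R)).
    by rewrite ler_pM2l// le_rho.
  by rewrite ltr_pM2r ?powR_gt0// /kappa ltr_pdivrMr ?ltr0n//; have := rho_lt_q; lra.
rewrite word_countE -powRN -powRrM -mulrA -rho_powD.
have -> : - (K * s) + (K + t) * s = t * s by ring.
rewrite rhoE -two_powD le2.
have : gamma * (t * s) <= gamma * s * k.+1%:R.
  by rewrite -mulrA ler_pM2l// mulrC ler_wpM2l// ltW.
lra.
Qed.

Let diam_level (r : R) : 0 < r <= kappa ->
  exists t k, r = rho `^ (K + t) /\ k%:R <= t < k.+1%:R.
Proof.
move=> /andP[r0 rk]; have t0 : 0 <= level r - K.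
  by rewrite subr_ge0 -le_rho levelK// kappaE.
exists (level r - K), (Num.truncn (level r - K)); split; last exact: truncn_itv.
by rewrite addrC subrK levelK.
Qed.

(** The count exponent lies above the line of slope phi (1 / L^2) at all
    levels, so sets of all small diameters have small mass. *)
Lemma block_moran_hausdorff_dim_ge :
  ((phi (1 / L%:R ^+ 2) / gamma)%:E <= hausdorff_dim E)%E.
Proof.
apply: le_ereal_inf_tmp => _ [s [s0 Hs] <-]; rewrite lee_fin ler_pdivrMr//.
rewrite leNgt mulrC; apply/negP => lts.
pose C : R := 2 `^ 0 * rho `^ (- (K * s)).
have C0 : 0 < C by rewrite mulr_gt0 ?powR_gt0.
have : (hausdorff_premeasure s kappa E < (1 / (2 * C))%:E)%E.
  apply: (@le_lt_trans _ _ 0%E); last by rewrite lte_fin divr_gt0// mulr_gt0.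
  by rewrite -Hs; apply: ereal_sup_ubound; exists kappa.
move=> /ereal_inf_lt[_ [D [U [cov diam_itv ->]]] small].
have : (1 <= C%:E * diam_sum s D U)%E.
  apply: mass_le => // i iD; have := diam_itv i iD; have := diam_ge0 R 1 (U i).
  case: (diam (U i)) => [r|//|//]; rewrite !lee_fin le_eqVlt => /orP[/eqP<-|r0] rk.
    by left.
  right; have [|t [k [-> kt]]] := diam_level r; first by rewrite r0.
  exists t, k; split=> //; rewrite subr0.
  apply: le_trans (count_exponent_global L m L_ge2 m_ge1 R k.+1 isT).
  by rewrite ler_wpM2r// ltW.
apply/negP; rewrite -ltNge; apply: (@le_lt_trans _ _ (C%:E * (1 / (2 * C))%:E)%E).
  by apply: lee_wpmul2l; [rewrite lee_fin ltW | exact: ltW].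
rewrite -EFinM lte_fin; have -> : C * (1 / (2 * C)) = 2^-1 by field; rewrite gt_eqF.
lra.
Qed.

(** At the scales rho^t given by the left ends t = T w of the critical windows,
    all admissible diameters correspond to levels in the window, where
    count_exponent_lower bounds the number of intervals from below. *)
Lemma block_moran_upper_dim_ge (theta : R) : 0 < theta <= 1 ->
  ((phi theta / gamma)%:E <= upper_intermediate_dim theta E)%E.
Proof.
move=> /andP[th0 th1].
apply: le_ereal_inf_tmp => _ [s [s0 Hs] <-]; rewrite lee_fin ler_pdivrMr//.
rewrite leNgt mulrC; apply/negP => lts.
pose C : R := 2 `^ (m%:R * K) * rho `^ (- (K * s)).
have C0 : 0 < C by rewrite mulr_gt0 ?powR_gt0.
have [|Delta [Delta0 cov]] := Hs (1 / (2 * C)); first by rewrite divr_gt0// mulr_gt0.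
have sL : 0 < 1 + L%:R :> R by rewrite addr_gt0 ?ltr0n.
have sLth : 0 < 1 + L%:R * theta :> R by rewrite addr_gt0 ?mulr_gt0 ?ltr0n.
pose w : R := (1 + L%:R * theta) / (1 + L%:R).
have [|j] := pow_unbounded (Num.max (level Delta) K) w (fun j => j.*2.+1) ltac:(exact: divr_gt0).
  by move=> j; rewrite -addnn -addnS leq_addr.
set t := _ * w; rewrite ge_max => /andP[tD tK].
have tE : t * (1 + L%:R) = (L ^ j.*2.+1)%:R * (1 + L%:R * theta).
  by rewrite /t /w mulrA divfK// gt_eqF.
have [|D [U [cov' diam_itv small]]] := cov (rho `^ t).
  by rewrite powR_gt0//= -[leRHS](levelK _ Delta0) le_rho.
have : (1 <= C%:E * diam_sum s D U)%E.
  apply: mass_le => // i iD; have := diam_itv i iD.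
  rewrite /lower_scale gt_eqF//; case: (diam (U i)) => [r|/andP[]//|/andP[]//] /andP[].
  rewrite !lee_fin => lo hi.
  have r0 : 0 < r by apply: lt_le_trans lo; rewrite !powR_gt0.
  right; have [|u [k [rE ku]]] := diam_level r.
    by rewrite r0/=; apply: le_trans hi _; rewrite -kappaE le_rho.
  exists u, k; split=> //; first by rewrite rE.
  have /andP[ku1 uk1] := ku.
  move: lo hi; rewrite rE -powRrM !le_rho ler_pdivlMr// => lo hi.
  apply: (@le_trans _ _ (phi theta * k.+1%:R - m%:R * K)).
    by rewrite lerD2r ler_wpM2r// ltW.
  apply: (count_exponent_lower L m L_ge2 m_ge1 R theta K j) => //; first by rewrite th0.
    by rewrite -tE ler_pM2r// addrC; apply: le_trans hi _; rewrite lerD2l ltW.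
  rewrite -tE ler_pM2r// -natr1 addrK; apply: le_trans lo; rewrite ler_pM2r//.
  by apply: le_trans ku1 _; rewrite lerDr.
apply/negP; rewrite -ltNge; apply: (@le_lt_trans _ _ (C%:E * (1 / (2 * C))%:E)%E).
  by apply: lee_wpmul2l; [rewrite lee_fin ltW | ].
rewrite -EFinM lte_fin; have -> : C * (1 / (2 * C)) = 2^-1 by field; rewrite gt_eqF.
lra.
Qed.

End BlockMoranSet.

(** * Intermediate dimensions of prescribed form *)

Theorem proposition1p6 (R : realType) (L : nat) (hL : (2 <= L)%N)
    (f : R -> R) (hf : family_F L f) :
  exists (d : nat) (E : set 'rV[R]_d),
    [/\ (1 <= d)%N,
        homogeneous_moran_set E,
        forall theta : R, 1 / L%:R ^+ 2 <= theta <= 1 ->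
          upper_intermediate_dim theta E = (f theta)%:E,
        forall theta : R, 0 <= theta <= 1 / L%:R ^+ 2 ->
          upper_intermediate_dim theta E = hausdorff_dim E
      & forall theta : R, 0 <= theta <= 1 ->
          lower_intermediate_dim theta E = hausdorff_dim E].
Proof.
case: hf => a [b [c [ac ba b0 [m abm] fE]]].
have m_ge1 : (1 <= m)%N by rewrite -(ler1n R) -abm ler_pdivlMr ?mul1r.
have m_lt : m%:R < c / b by rewrite -abm ltr_pM2r ?invr_gt0.
have f_profile theta : 0 <= theta <= 1 -> f theta = profile L m R theta / (c / b).
  move=> thP; rewrite fE//; have /andP[th0 _] := thP.
  have c0 : 0 < c by apply: lt_trans ac; apply: lt_le_trans ba.
  have den : 0 < 1 + L%:R * theta by rewrite ltr_wpDr ?mulr_ge0.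
  have -> : a = m%:R * b by rewrite -abm divfK ?gt_eqF.
  rewrite /profile; field; rewrite !gt_eqF//=.
  have -> : L%:R * c * theta + c = c * (1 + L%:R * theta) by ring.
  exact: mulr_gt0.
have L0 : 0 < L%:R :> R by rewrite ltr0n ltnW.
have i0 : 0 < 1 / (L%:R : R) ^+ 2 by rewrite divr_gt0 ?exprn_gt0.
have i1 : 1 / (L%:R : R) ^+ 2 <= 1.
  by rewrite ler_pdivrMr ?exprn_gt0// mul1r exprn_ege1// ler1n ltnW.
pose E := block_moran_set R L m (c / b).
have upper_le := block_moran_upper_dim_le R L m (c / b) hL m_ge1 m_lt.
have upper_ge := block_moran_upper_dim_ge R L m (c / b) hL m_ge1 m_lt.
have lower_le := block_moran_lower_dim_le R L m (c / b) hL m_ge1 m_lt.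
have haus_ge := block_moran_hausdorff_dim_ge R L m (c / b) hL m_ge1 m_lt.
have haus_lower theta := hausdorff_le_lower_intermediate_dim R 1 theta E.
have lower_upper theta := lower_le_upper_intermediate_dim R 1 theta E.
exists 1%N, E; split=> //.
- exact: block_moran_homogeneous.
- move=> theta thP; have /andP[th0 th1] := thP; have th_gt0 := lt_le_trans i0 th0.
  rewrite f_profile ?th1 ?andbT; last exact: ltW.
  by apply/eqP; rewrite eq_le upper_le// upper_ge// th_gt0.
- move=> theta /andP[th0 th1]; apply/eqP; rewrite eq_le; apply/andP; split.
    apply: le_trans haus_ge; apply: le_trans (upper_le _ _); last by rewrite lexx.
    by apply: upper_intermediate_dim_le; rewrite th0.
  exact: le_trans (haus_lower theta) (lower_upper theta).
- move=> theta thP; apply/eqP; rewrite eq_le haus_lower andbT.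
  exact: le_trans (lower_le _ thP) haus_ge.
Qed.
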